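(* Let $X$, $X_1$ and $X_2$ be real-valued random variables on a common probability space with finite second moments, and let $X(X_1,X_2) := \min(X_2, \max(X,X_1))$ (pointwise). Then $$\mathrm{Var}(X(X_1,X_2)) \le \mathrm{Var}(X_2) + \mathrm{Var}(X_1) + \mathrm{Var}(X).$$
   Context: The notation $X(X_1,X_2)$ denotes the truncation of $X$ by $X_2$ from above and by $X_1$ from below; no independence, common distribution, or ordering of $X$, $X_1$, $X_2$ is assumed. *)

(* Defs.v *)
From HB Require Import structures.
From mathcomp Require Import all_boot all_order all_algebra.
From mathcomp Require Import all_classical all_reals all_analysis.

Set Implicit Arguments.
Unset Strict Implicit.
Unset Printing Implicit Defensive.

Import Order.TTheory GRing.Theory Num.Theory.

Local Open Scope ring_scope.

(* No ordering of the bounds is assumed; where [X2 w < X1 w] the upper bound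
   wins, since the lower truncation is applied first. *)
Definition truncation (T : Type) (R : realType) (X X1 X2 : T -> R) : T -> R :=
  fun w => Num.min (X2 w) (Num.max (X w) (X1 w)).

Definition finite_second_moment (d : measure_display) (T : measurableType d)
    (R : realType) (P : probability T R) (X : T -> R) : Prop :=
  ('E_P[fun w => (X w ^+ 2)%R] < +oo)%E.

(* Main.v *)
Require Import Defs.
From HB Require Import structures.
From mathcomp Require Import all_boot all_order all_algebra.
From mathcomp Require Import all_classical all_reals all_analysis.
From mathcomp Require Import measurable_realfun lra.

Import Order.TTheory GRing.Theory Num.Theory.

Local Open Scope ring_scope.

(** Both [min] and [max] are 1-Lipschitz from the Euclidean plane to the line
([sqr_min_sub], [sqr_max_sub]), hence so is the map
(x, x1, x2) |-> min(x2, max(x, x1)) from the Euclidean space to the line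
([sqr_clamp_sub]). Let m, m1, m2 be the means of X, X1, X2, let Z be the
truncation and c := min(m2, max(m, m1)). Pointwise, then,
<<
  (Z - c)^2 <= (X2 - m2)^2 + (X1 - m1)^2 + (X - m)^2.
>>
Among constants the mean minimizes the quadratic deviation, so that
Var(Z) <= E[(Z - c)^2] ([variance_le_sqr_dev]), and taking expectations
concludes. The same pointwise bound with all the centers equal to 0 shows that Z
is square integrable. *)

Lemma sqr_max_sub (R : realDomainType) (x y a b : R) :
  (Num.max x y - Num.max a b) ^+ 2 <= (x - a) ^+ 2 + (y - b) ^+ 2.
Proof.
(* When the two extrema are attained at different places, the inequality follows
   from one of the last two squares and the product of the two comparisons. *)
have := (sqr_ge0 (x - a), sqr_ge0 (y - b), sqr_ge0 (x - b), sqr_ge0 (y - a)).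
by move=> [[[? ?] ?] ?]; case: (ltP x y) => ?; case: (ltP a b) => ?; nra.
Qed.

Lemma sqr_min_sub (R : realDomainType) (x y a b : R) :
  (Num.min x y - Num.min a b) ^+ 2 <= (x - a) ^+ 2 + (y - b) ^+ 2.
Proof.
have := (sqr_ge0 (x - a), sqr_ge0 (y - b), sqr_ge0 (x - b), sqr_ge0 (y - a)).
by move=> [[[? ?] ?] ?]; case: (ltP x y) => ?; case: (ltP a b) => ?; nra.
Qed.

Lemma sqr_clamp_sub (R : realDomainType) (x x1 x2 m m1 m2 : R) :
  (Num.min x2 (Num.max x x1) - Num.min m2 (Num.max m m1)) ^+ 2
    <= (x2 - m2) ^+ 2 + (x1 - m1) ^+ 2 + (x - m) ^+ 2.
Proof.
apply: le_trans (sqr_min_sub _ _ _ _ _) _.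
by rewrite -addrA lerD2l [leRHS]addrC sqr_max_sub.
Qed.

Section second_moment.
Local Open Scope ereal_scope.
Context (d : measure_display) (T : measurableType d) (R : realType)
  (P : probability T R).

Lemma finite_second_moment_Lfun2 (f : T -> R) :
  measurable_fun setT f -> finite_second_moment P f -> f \in Lfun P 2%:E.
Proof.
move=> mf f2; rewrite inE; apply/andP; split; rewrite inE//=.
rewrite /finite_norm unlock/= poweR_lty//.
move: f2; rewrite /finite_second_moment unlock; apply: le_lt_trans.
rewrite le_eqVlt; apply/orP; left; apply/eqP; apply: eq_integral => x _ /=.
by rewrite powR_mulrn// -normrX ger0_norm ?sqr_ge0.
Qed.

Lemma variance_le_sqr_dev (f : T -> R) (c : R) :
  f \in Lfun P 2%:E -> 'V_P[f] <= 'E_P[fun w => ((f w - c) ^+ 2)%R].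
Proof.
move=> f2; rewrite -(varianceB_cst_r c f2) varianceE; last first.
  by rewrite rpredB ?lee1n//= => _; exact: Lfun_cst.
rewrite -[leRHS]sube0; apply: leeB.
  by rewrite le_eqVlt eqxx.
exact: sqre_ge0.
Qed.

(** No integrability is needed: both sides may be infinite. *)
Lemma expectation_sqrD3 (f g h : T -> R) :
  measurable_fun setT f -> measurable_fun setT g -> measurable_fun setT h ->
  'E_P[fun w => (f w ^+ 2 + g w ^+ 2 + h w ^+ 2)%R] =
  'E_P[fun w => (f w ^+ 2)%R] + 'E_P[fun w => (g w ^+ 2)%R]
    + 'E_P[fun w => (h w ^+ 2)%R].
Proof.
move=> mf mg mh; rewrite unlock.
have msq (k : T -> R) : measurable_fun setT k ->
    measurable_fun setT (fun w => (k w ^+ 2)%:E).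
  by move=> mk; apply/measurable_EFinP; exact: measurable_funX.
have sq0 (k : T -> R) w : 0 <= (k w ^+ 2)%:E by rewrite lee_fin sqr_ge0.
under eq_integral do rewrite !EFinD.
rewrite ge0_integralD//; [|by move=> w _; rewrite adde_ge0| |exact: msq].
  by rewrite ge0_integralD//; exact: msq.
by apply: emeasurable_funD; exact: msq.
Qed.

Lemma le_expectation_sqr (f g1 g2 g3 : T -> R) :
  measurable_fun setT f -> measurable_fun setT g1 ->
  measurable_fun setT g2 -> measurable_fun setT g3 ->
  (forall w, f w ^+ 2 <= g1 w ^+ 2 + g2 w ^+ 2 + g3 w ^+ 2)%R ->
  'E_P[fun w => (f w ^+ 2)%R] <=
  'E_P[fun w => (g1 w ^+ 2)%R] + 'E_P[fun w => (g2 w ^+ 2)%R]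
    + 'E_P[fun w => (g3 w ^+ 2)%R].
Proof.
move=> mf mg1 mg2 mg3 fg; rewrite -expectation_sqrD3// unlock.
apply: ge0_le_integral => //.
- by move=> w _; rewrite lee_fin sqr_ge0.
- by apply/measurable_EFinP; exact: measurable_funX.
- apply/measurable_EFinP.
  by do ?apply: measurable_funD; exact: measurable_funX.
- by move=> w _; rewrite lee_fin.
Qed.

End second_moment.

Theorem corollary2 (d : measure_display) (T : measurableType d) (R : realType)
    (P : probability T R) (X X1 X2 : {RV P >-> R})
    (hX : finite_second_moment P X)
    (hX1 : finite_second_moment P X1)
    (hX2 : finite_second_moment P X2) :
  ('V_P[truncation X X1 X2] <= 'V_P[X2] + 'V_P[X1] + 'V_P[X])%E.
Proof.
have mX : measurable_fun setT X by [].
have mX1 : measurable_fun setT X1 by [].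
have mX2 : measurable_fun setT X2 by [].
have mZ : measurable_fun setT (truncation X X1 X2).
  by apply: measurable_minr => //; exact: measurable_maxr.
have Z2 : truncation X X1 X2 \in Lfun P 2%:E.
  apply: finite_second_moment_Lfun2 => //; rewrite /finite_second_moment.
  have bound w : truncation X X1 X2 w ^+ 2 <= X2 w ^+ 2 + X1 w ^+ 2 + X w ^+ 2.
    have := sqr_clamp_sub _ (X w) (X1 w) (X2 w) 0 0 0.
    by rewrite maxxx minxx !subr0.
  apply: (le_lt_trans (@le_expectation_sqr _ _ _ P _ _ _ _ mZ mX2 mX1 mX bound)).
  by rewrite !lte_add_pinfty.
pose mean (Y : T -> R) : R := fine 'E_P[Y]%E.
have varE (Y : T -> R) : ('V_P[Y] = 'E_P[fun w => ((Y w - mean Y) ^+ 2)%R])%E.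
  by rewrite /variance unlock.
(* The center is the truncation of the means, not the mean of the truncation. *)
apply: le_trans (@variance_le_sqr_dev _ _ _ P _
  (Num.min (mean X2) (Num.max (mean X) (mean X1))) Z2) _.
rewrite !varE; apply: le_expectation_sqr; try exact: measurable_funB.
by move=> w; exact: sqr_clamp_sub.
Qed.
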